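(* Let $K=\mathbb{F}_q$ be a finite field. Let $\mathcal{G}$ be a bipartite simple graph with a perfect matching, with $2k$ vertices and $s$ edges, and let $\mathbb{X}\subseteq\mathbb{P}^{s-1}$ be the toric set over $K$ parameterized by its edges, with vanishing ideal $I_{\mathbb{X}}\subseteq S=K[X_1,\ldots,X_s]$. Let $I_{\mathbb{T}_{k-1}}\subseteq R$ be the vanishing ideal of the projective torus $\mathbb{T}_{k-1}$, where $R$ is the polynomial ring over $K$ in $k$ variables. Then $$\mathrm{reg}(S/I_{\mathbb{X}})\geq \mathrm{reg}(R/I_{\mathbb{T}_{k-1}})=(q-2)(k-1),$$ and this lower bound is tight: it is attained when $\mathcal{G}$ is an even cycle, and when $\mathcal{G}$ is a complete bipartite graph of the form $\mathcal{K}_{m,m}$.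
   Context: Let $K^*=K\setminus\{0\}$. For a simple graph $\mathcal{G}$ with vertices $v_1,\ldots,v_n$ and edges $e_1,\ldots,e_s$, the toric set parameterized by the edges of $\mathcal{G}$ is the set $\mathbb{X}\subseteq\mathbb{P}^{s-1}$ of all points, for $(t_1,\ldots,t_n)\in(K^* )^n$, whose $i$-th coordinate is $t_jt_l$ when $e_i=\{v_j,v_l\}$. The projective torus is $\mathbb{T}_{k-1}=\{[t_1,\ldots,t_k]\in\mathbb{P}^{k-1}: t_i\in K^*\}$. For a finite set of points $\mathbb{Z}\subseteq\mathbb{P}^{r-1}$ and $A=K[X_1,\ldots,X_r]=\oplus_{d\ge0}A_d$ with the standard grading, $I_{\mathbb{Z}}\subseteq A$ is the ideal generated by the homogeneous polynomials vanishing at all points of $\mathbb{Z}$, $H_{\mathbb{Z}}(d)=\dim_K(A_d/(I_{\mathbb{Z}}\cap A_d))$, and the regularity index $\mathrm{reg}(A/I_{\mathbb{Z}})$ is the least integer $d\ge0$ such that $H_{\mathbb{Z}}(d)=|\mathbb{Z}|$. *)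

(* Defs.v *)
From mathcomp Require Import all_boot all_algebra.
From mathcomp Require Export mpoly.

Set Implicit Arguments.
Unset Strict Implicit.
Unset Printing Implicit Defensive.

Import GRing.Theory.
Local Open Scope ring_scope.

Record sgraph := SGraph {
  vertex :> finType;
  adj : rel vertex;
  adj_sym : ssrbool.symmetric adj;
  adj_irr : irreflexive adj
}.

Definition edges (G : sgraph) : {set {set G}} :=
  [set [set p.1; p.2] | p : G * G & adj p.1 p.2].

Definition edge_enumeration (G : sgraph) (s : nat) (e : s.-tuple {set G}) : Prop :=
  uniq e /\ e =i edges G.

Definition bipartite (G : sgraph) : Prop :=
  exists A : {set G}, forall x y, adj x y -> (x \in A) != (y \in A).

Definition has_perfect_matching (G : sgraph) : Prop :=
  exists M : {set {set G}}, M \subset edges G /\ partition M [set: G].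

Definition graph_iso (G H : sgraph) : Prop :=
  exists f : G -> H, bijective f /\ forall x y, adj (f x) (f y) = adj x y.

(* [ordS i] is [i + 1] modulo [n]; this is the cycle of length [n] for [2 < n]. *)
Definition cycle_rel (n : nat) : rel 'I_n :=
  fun i j => (i != j) && ((ordS i == j) || (ordS j == i)).

Fact cycle_rel_sym n : ssrbool.symmetric (@cycle_rel n).
Proof. by move=> i j; rewrite /cycle_rel eq_sym orbC. Qed.

Fact cycle_rel_irr n : irreflexive (@cycle_rel n).
Proof. by move=> i; rewrite /cycle_rel eqxx. Qed.

Definition cycle_graph (n : nat) : sgraph :=
  SGraph (@cycle_rel_sym n) (@cycle_rel_irr n).

Definition complete_bipartite_rel (m n : nat) : rel ('I_m + 'I_n) :=
  fun x y => match x, y with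
             | inl _, inr _ | inr _, inl _ => true
             | _, _ => false
             end.

Fact complete_bipartite_rel_sym m n : ssrbool.symmetric (@complete_bipartite_rel m n).
Proof. by case=> i [] j. Qed.

Fact complete_bipartite_rel_irr m n : irreflexive (@complete_bipartite_rel m n).
Proof. by case. Qed.

Definition complete_bipartite (m n : nat) : sgraph :=
  SGraph (@complete_bipartite_rel_sym m n) (@complete_bipartite_rel_irr m n).

Section ProjectiveSets.

Variable K : finFieldType.

(* For [x != 0], the point [x_1, ..., x_r] of P^(r-1), as the set of all its
   homogeneous coordinate vectors. *)
Definition hclass (r : nat) (x : 'rV[K]_r) : {set 'rV[K]_r} :=
  [set c *: x | c : K & c != 0].

Definition is_ppoint (r : nat) (P : {set 'rV[K]_r}) : bool :=
  [exists x : 'rV[K]_r, (x != 0) && (P == hclass x)].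

(* P^(r-1): the index is the number of homogeneous coordinates. *)
Definition proj_space (r : nat) : Type := {P : {set 'rV[K]_r} | is_ppoint P}.

Definition proj_torus (k : nat) : {set proj_space k} :=
  [set P | [exists t : 'rV[K]_k,
              [forall i, t 0 i != 0] && (sval P == hclass t)]].

(* The product over the vertices of the edge {v_j, v_l} is t_j * t_l. *)
Definition edge_monomials (G : sgraph) (s : nat) (e : s.-tuple {set G})
    (t : {ffun G -> K}) : 'rV[K]_s :=
  \row_(i < s) \prod_(v in tnth e i) t v.

Definition toric_set (G : sgraph) (s : nat) (e : s.-tuple {set G}) :
    {set proj_space s} :=
  [set P | [exists t : {ffun G -> K},
              [forall v, t v != 0] && (sval P == hclass (edge_monomials e t))]].

Definition vanishes_on (r : nat) (Z : {set proj_space r}) (p : {mpoly K[r]}) : Prop :=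
  forall P, P \in Z -> forall x, x \in sval P -> p.@[fun i => x 0 i] = 0.

(* Each pair in [l] is a coefficient and a homogeneous generator. *)
Definition vanishing_ideal (r : nat) (Z : {set proj_space r}) (p : {mpoly K[r]}) :
    Prop :=
  exists l : seq ({mpoly K[r]} * {mpoly K[r]}),
    (forall ag, ag \in l ->
       (exists d : nat, ag.2 \is d.-homog) /\ vanishes_on Z ag.2) /\
    p = \sum_(ag <- l) ag.1 * ag.2.

(* For subspaces [W] of [A], the quotient A / W has a basis of [h] elements,
   namely the classes of the [b i]. *)
Definition quotient_dim (V : lmodType K) (A W : V -> Prop) (h : nat) : Prop :=
  exists b : 'I_h -> V,
    (forall i, A (b i)) /\
    forall v, A v -> exists! c : 'rV[K]_h, W (v - \sum_(i < h) c 0 i *: b i).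

(* H_Z(d) = h. *)
Definition hilbert_value (r : nat) (Z : {set proj_space r}) (d h : nat) : Prop :=
  quotient_dim (fun p : {mpoly K[r]} => p \is d.-homog)
               (fun p : {mpoly K[r]} => vanishing_ideal Z p /\ p \is d.-homog) h.

Definition regularity_index (r : nat) (Z : {set proj_space r}) (m : nat) : Prop :=
  hilbert_value Z m #|Z| /\ forall d, hilbert_value Z d #|Z| -> (m <= d)%N.

End ProjectiveSets.

Arguments proj_torus K k : clear implicits.
Arguments toric_set K {G s} e.

(* Main.v *)
(** Evaluation identifies the degree-d part of the coordinate ring with functions
    on Z, so H_Z(d) = |Z| means that homogeneous polynomials of degree d
    interpolate every function on Z. Write N = q - 1, the exponent of K^*.

    Lower bound: putting t = 1 on one side of the bipartition embeds the torus
    T_{k-1} linearly in X, so interpolation on X restricts to the torus. There the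
    sum of (x_1...x_k) p(x) over x_k = 1 vanishes for deg p < (q-2)(k-1), since
    some factor is a sum of y^j over K^* with 0 < j < N, but it is nonzero
    if p separates (1,...,1) from the other points.

    Upper bound: the indicator function of a point is a combination of monomials
    of degree congruent to d mod N, so it suffices to replace each of these by a
    monomial of degree d with the same values. Exponents may be reduced mod N.
    For a torus the reduced degree is at most k(N-1) < d + N when
    d = (q-2)(k-1), and being congruent to d it is at most d. For K_{m,m} this
    applies to the vertex degrees on both sides, and any two degree sequences of
    equal sum are realised by a multiset of edges. For an even cycle the two
    perfect matchings have the same product of coordinates, and averaging over
    the shifts of exponents by this relation gives a reduced degree of at most
    k(N-1) again. *)
Require Import Defs.
From mathcomp Require Import all_boot all_algebra all_field.
From mathcomp Require Import ring zify.
From Stdlib Require Import Classical.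

Set Implicit Arguments.
Unset Strict Implicit.
Unset Printing Implicit Defensive.

Import GRing.Theory.

(** * Hilbert function values and interpolation on finite sets of projective points *)

Section Interpolation.
Local Open Scope ring_scope.
Variable K : finFieldType.

Lemma homog_meval_scale (s d : nat) (p : {mpoly K[s]}) (c : K) (x : 'rV[K]_s) :
  p \is d.-homog ->
  p.@[fun i => (c *: x) 0 i] = c ^+ d * p.@[fun i => x 0 i].
Proof.
move=> hp; rewrite !mevalE mulr_sumr !big_seq; apply: eq_bigr => m mp.
rewrite mulrCA; congr (_ * _).
rewrite (eq_bigr (fun i => c ^+ m i * x 0 i ^+ m i)); last first.
  by move=> i _; rewrite mxE exprMn.
by rewrite big_split /= prodrXr -mdegE (dhomogP _ _ _ hp m mp).
Qed.

Lemma vanishes_onE (r : nat) (Z : {set proj_space K r}) (p : {mpoly K[r]}) d :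
  p \is d.-homog -> (vanishing_ideal Z p <-> vanishes_on Z p).
Proof.
move=> hp; split=> [[l [hl ->]] P PZ x xP | vp].
  rewrite raddf_sum /= big_seq big1 // => ag agl.
  have [_ v] := hl _ agl.
  by rewrite rmorphM /= (v P PZ x xP) mulr0.
exists [:: (1, p)]; split; last by rewrite big_seq1 mul1r.
by move=> ag; rewrite inE => /eqP -> /=; split=> //; exists d.
Qed.

Lemma mem_hclass (r : nat) (x : 'rV[K]_r) : x \in hclass x.
Proof. by apply/imsetP; exists 1; rewrite ?scale1r // inE oner_eq0. Qed.

Lemma ppoint_rep (r : nat) (P : proj_space K r) :
  exists x : 'rV[K]_r, sval P = hclass x.
Proof. by case: P => P /= /existsP[x /andP[_ /eqP ->]]; exists x. Qed.

Lemma homog_vanish_class (r d : nat) (p : {mpoly K[r]}) (x y : 'rV[K]_r) :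
  p \is d.-homog -> y \in hclass x -> p.@[fun i => x 0 i] = 0 ->
  p.@[fun i => y 0 i] = 0.
Proof.
by move=> hp /imsetP[c _ ->] px; rewrite (homog_meval_scale _ _ hp) px mulr0.
Qed.

(** One separating form per point suffices, by linearity. Quantifying over all coordinate vectors of
    a point avoids choosing representatives; homogeneity makes this harmless. *)
Definition interpolates (r : nat) (Z : {set proj_space K r}) (d : nat) : Prop :=
  forall P, P \in Z -> exists p : {mpoly K[r]},
    [/\ p \is d.-homog,
        forall x, x \in sval P -> p.@[fun i => x 0 i] != 0 &
        forall Q, Q \in Z -> Q != P ->
          forall x, x \in sval Q -> p.@[fun i => x 0 i] = 0].

(** A basis of the quotient has a square evaluation matrix with trivial kernel, so its inverse
    yields separating forms. Conversely, separating forms scaled to the value 1 at their own point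
    are a basis dual to evaluation. *)
Lemma hilbert_value_card (r : nat) (Z : {set proj_space K r}) (d : nat) :
  hilbert_value Z d #|Z| <-> interpolates Z d.
Proof.
have [rep repP] := fin_all_exists (@ppoint_rep r).
have repin P : rep P \in sval P by rewrite repP mem_hclass.
pose x (i : 'I_#|Z|) := rep (enum_val i).
pose ev (p : {mpoly K[r]}) i := p.@[fun j => x i 0 j].
have ev0 i : ev 0 i = 0 by rewrite /ev raddf0.
have evL (b : 'I_#|Z| -> {mpoly K[r]}) (c : 'rV_#|Z|) i :
    ev (\sum_j c 0 j *: b j) i = \sum_j c 0 j * ev (b j) i.
  by rewrite /ev raddf_sum /=; apply: eq_bigr => j _; rewrite mevalZ.
have evZ a p i : ev (a *: p) i = a * ev p i by exact: mevalZ.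
have evB p p' i : ev (p - p') i = ev p i - ev p' i by exact: mevalB.
have WP p : p \is d.-homog ->
    (vanishing_ideal Z p /\ p \is d.-homog <-> forall i, ev p i = 0).
  move=> hp; split=> [[/(vanishes_onE _ hp) v _] i | v].
    exact: v (enum_valP i) _ (repin _).
  split=> //; apply/(vanishes_onE _ hp) => P PZ y; rewrite repP => yP.
  apply: homog_vanish_class hp yP _.
  by have := v (enum_rank_in PZ P); rewrite /ev /x enum_rankK_in.
split.
  move=> [b [hb ub]] P PZ.
  have hL (c : 'rV_#|Z|) : \sum_j c 0 j *: b j \is d.-homog.
    by apply: rpred_sum => j _; apply: rpredZ.
  pose B : 'M[K]_#|Z| := \matrix_(i, j) ev (b i) j.
  have cB (c : 'rV_#|Z|) i : (c *m B) 0 i = ev (\sum_j c 0 j *: b j) i.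
    by rewrite evL mxE; apply: eq_bigr => j _; rewrite mxE.
  (* A combination of the basis that vanishes at every point lies in the ideal, so its coefficients
     and the zero row both represent the class of 0. *)
  have injB (c : 'rV_#|Z|) : c *m B = 0 -> c = 0.
    move=> cB0; have [c' [_ uc']] := ub 0 (rpred0 _).
    have W0 (c0 : 'rV_#|Z|) : c0 *m B = 0 ->
        vanishing_ideal Z (0 - \sum_j c0 0 j *: b j) /\
        0 - \sum_j c0 0 j *: b j \is d.-homog.
      move=> c0B; apply/WP; first by rewrite rpredB ?rpred0 ?hL.
      by move=> i; rewrite evB ev0 -cB c0B mxE subrr.
    by rewrite -(uc' c (W0 _ cB0)) -(uc' 0 (W0 _ (mul0mx _ _))).
  have Bfree : row_free B.
    rewrite -kermx_eq0; apply/eqP/row_matrixP => i; rewrite row0.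
    by apply: injB; apply/sub_kermxP; exact: row_sub.
  have Bu : B \in unitmx by rewrite -row_free_unit.
  pose i0 := enum_rank_in PZ P.
  (* Solves [c *m B = delta_mx 0 i0]: the value is 1 at [P] and 0 at the other points. *)
  pose c := delta_mx 0 i0 *m invmx B : 'rV_#|Z|.
  have evp i : ev (\sum_j c 0 j *: b j) i = (i == i0)%:R.
    by rewrite -cB /c mulmxKV // mxE eqxx.
  exists (\sum_j c 0 j *: b j); split=> // [y yP | Q QZ QP y yQ].
    apply/eqP => py0.
    have yx : x i0 \in hclass y.
      move: yP; rewrite repP => /imsetP[a a0 ->].
      rewrite inE in a0; apply/imsetP; exists a^-1; first by rewrite inE invr_eq0.
      by rewrite scalerA mulVf ?scale1r // /x enum_rankK_in.
    have := homog_vanish_class (hL c) yx py0.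
    by rewrite -/(ev _ i0) evp eqxx => /eqP; rewrite oner_eq0.
  move: yQ; rewrite repP => yQ; apply: homog_vanish_class (hL c) yQ _.
  have := evp (enum_rank_in QZ Q); rewrite /ev /x enum_rankK_in // => ->.
  case: eqP => // E; case/eqP: QP.
  by rewrite -(enum_rankK_in QZ QZ) E enum_rankK_in.
move=> hI.
have [p0 hp0] := fin_all_exists (fun i : 'I_#|Z| => hI _ (enum_valP i)).
have evii i : ev (p0 i) i != 0 by case: (hp0 i) => _ + _; apply; exact: repin.
have evij i j : i != j -> ev (p0 i) j = 0.
  move=> ij; case: (hp0 i) => _ _ h; apply: (h (enum_val j)) => //.
  - exact: enum_valP.
  - by apply: contra ij => /eqP/enum_val_inj ->.
  - exact: repin.
exists (fun i => (ev (p0 i) i)^-1 *: p0 i); split.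
  by move=> i; apply: rpredZ; case: (hp0 i).
move=> v hv.
have hD (c : 'rV_#|Z|) : v - \sum_j c 0 j *: ((ev (p0 j) j)^-1 *: p0 j) \is d.-homog.
  apply: rpredB => //; apply: rpred_sum => j _; do 2!apply: rpredZ.
  by case: (hp0 j).
have evD (c : 'rV_#|Z|) i :
    ev (v - \sum_j c 0 j *: ((ev (p0 j) j)^-1 *: p0 j)) i = ev v i - c 0 i.
  rewrite evB evL (bigD1 i) //= big1 => [|j ji].
    by rewrite addr0 evZ mulVf ?mulr1.
  by rewrite evZ (evij j i) // !mulr0.
exists (\row_i ev v i); split.
  by apply/WP => // i; rewrite evD mxE subrr.
move=> c /WP-/(_ (hD c)) h; apply/rowP => i.
by rewrite mxE; apply/eqP; rewrite -subr_eq0 -evD h.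
Qed.

End Interpolation.

(** * Power sums over the units of a finite field *)

Section FiniteFieldSums.
Local Open Scope ring_scope.
Variable K : finFieldType.

Lemma finField_card_pred_gt0 : (0 < #|K|.-1)%N.
Proof. by rewrite -subn1 subn_gt0 finNzRing_gt1. Qed.

Lemma expf_card_pred (x : K) : x != 0 -> x ^+ #|K|.-1 = 1.
Proof.
move=> x0; apply: (mulfI x0); rewrite mulr1 -exprS prednK ?expf_card //.
exact: ltnW (finNzRing_gt1 K).
Qed.

(** Translation by 1 permutes [K] and adds [#|K|] to the sum of its elements, so [#|K|] is 0 in [K]
    and [#|K|.-1] is -1. *)
Lemma natr_card_pred_neq0 : #|K|.-1%:R != 0 :> K.
Proof.
have h : #|K|%:R = 0 :> K.
  apply: (addrI (\sum_(x : K) x)); rewrite addr0.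
  rewrite [in RHS](reindex_inj (addIr (1 : K))) big_split /=; congr (_ + _).
  by rewrite sumr_const.
rewrite -(prednK (ltnW (finNzRing_gt1 K))) -natr1 in h.
by rewrite (canRL (addrK 1) h) sub0r oppr_eq0 oner_eq0.
Qed.

Lemma sum_geometric (r : K) :
  r != 0 -> r != 1 -> \sum_(j < #|K|.-1) r ^+ j = 0.
Proof.
move=> r0 r1; have := GRing.subrX1 r #|K|.-1.
rewrite expf_card_pred // subrr => /esym/eqP.
by rewrite mulf_eq0 subr_eq0 (negPf r1) => /eqP.
Qed.

(** Since X^j - 1 has at most j roots, some unit [g] has [g ^+ j != 1]. Multiplication by [g]
    permutes the units and scales the sum by [g ^+ j]. *)
Lemma sum_units_expr (j : nat) : (0 < j < #|K|.-1)%N ->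
  \sum_(y : K | y != 0) y ^+ j = 0.
Proof.
move=> /andP[j0 jN].
have [g g0 gj] : exists2 g : K, g != 0 & g ^+ j != 1.
  apply/exists_inP; apply: contraLR jN => /exists_inPn h.
  rewrite -leqNgt -(cardC1 (0 : K)) cardE.
  apply: max_unity_roots j0 _ (enum_uniq _).
  apply/allP => x; rewrite mem_enum inE => /h; rewrite negbK => ?.
  exact/unity_rootP/eqP.
set S := \sum_(y | _) _.
have E : S = g ^+ j * S.
  rewrite {1}/S (reindex_inj (mulfI g0)) mulr_sumr; apply: eq_big => y.
    by rewrite mulf_eq0 (negPf g0).
  by rewrite exprMn.
apply/eqP; have /eqP : (1 - g ^+ j) * S = 0 by rewrite mulrBl mul1r -E subrr.
by rewrite mulf_eq0 subr_eq0 eq_sym (negPf gj).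
Qed.

End FiniteFieldSums.

(** * General lower and upper bounds for interpolation degrees *)

Section Bounds.
Local Open Scope ring_scope.
Variable K : finFieldType.

(* The points off [(1, ..., 1)] contribute nothing to the sum over the torus of
   [\prod_i x_i] times a polynomial interpolating [(1, ..., 1)], whereas the
   sum of every monomial of small degree vanishes. *)
Lemma interpolates_lower_bound (T : finType) (s d : nat)
    (Z : {set proj_space K s}) (sigma : 'I_s -> T) :
  (forall x : T -> K, (forall i, x i != 0) ->
     exists2 P, P \in Z & sval P = hclass (\row_j x (sigma j))) ->
  interpolates Z d ->
  ((#|K| - 2) * (#|[set sigma j | j in 'I_s]| - 1) <= d)%N.
Proof.
move=> hZ hI; set B := [set _ | _ in _].
have [->|[i0 i0B]] := set_0Vmem B; first by rewrite cards0 sub0n muln0.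
have -> : (#|B| - 1 = #|B :\ i0|)%N by rewrite (cardsD1 i0 B) i0B add1n subn1.
have -> : (#|K| - 2 = #|K|.-1.-1)%N by rewrite subn2.
rewrite leqNgt; apply/negP => dlt.
have [P1 P1Z eP1] := hZ (fun=> 1) (fun=> oner_neq0 K).
have [p [hp pP1 pQ]] := hI _ P1Z.
(* Setting the coordinate [i0] to 1 selects one vector for each point of the torus; the coordinates
   outside [B] do not enter the polynomial and are frozen at 1. *)
pose Q (i : T) : pred K := fun y => if i \in B :\ i0 then y != 0 else y == 1.
have Q0 (f : {ffun T -> K}) i : f \in family Q -> f i != 0.
  move=> /familyP/(_ i); rewrite unfold_in /Q; case: ifP => // _ /eqP ->.
  exact: oner_neq0.
pose S := \sum_(f in family Q)
  (\prod_(i in B :\ i0) f i) * p.@[fun j => f (sigma j)].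
have S1 : S != 0.
  pose one := [ffun _ : T => 1 : K].
  have oneQ : one \in family Q.
    apply/familyP => i; rewrite unfold_in /Q ffunE; case: ifP => _ //.
    exact: oner_neq0.
  rewrite /S (bigD1 one) //= [X in _ + X]big1 => [|f /andP[fQ f1]].
    rewrite addr0 big1 => [|i _]; last by rewrite ffunE.
    rewrite mul1r.
    have := pP1 (\row_j 1); rewrite eP1 mem_hclass => /(_ isT).
    rewrite (_ : p.@[_] = p.@[fun j => one (sigma j)]) //.
    by apply: meval_eq => j; rewrite mxE ffunE.
  have [P PZ eP] := hZ f (fun i => Q0 f i fQ).
  rewrite (_ : p.@[_] = p.@[fun j => (\row_j f (sigma j)) 0 j]); last first.
    by apply: meval_eq => j; rewrite mxE.
  rewrite (pQ _ PZ) ?mulr0 ?eP ?mem_hclass //.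
  (* If [f] represents the point (1, ..., 1), it is constant on [B], and the constant is
     [f i0 = 1]. *)
  apply: contra f1 => /eqP PP1.
  have : \row_j f (sigma j) \in sval P by rewrite eP mem_hclass.
  rewrite PP1 eP1 => /imsetP[c _ /rowP ec].
  have fB j : f (sigma j) = c by have := ec j; rewrite !mxE mulr1.
  have fi0 : f i0 = 1.
    by move/familyP: fQ => /(_ i0); rewrite unfold_in /Q !inE eqxx => /eqP.
  have c1 : c = 1 by case/imsetP: i0B fi0 => j _ ->; rewrite fB.
  apply/eqP/ffunP => i; rewrite ffunE.
  have [/imsetP[j _ ->]|iB] := boolP (i \in B); first by rewrite fB.
  by move/familyP: fQ => /(_ i); rewrite unfold_in /Q !inE (negPf iB) andbF => /eqP.
case/eqP: S1; rewrite /S.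
under eq_bigr do rewrite mevalE mulr_sumr.
rewrite exchange_big /= big_seq big1 // => m mp.
pose e i := ((i \in B :\ i0) + \sum_(j | sigma j == i) m j)%N.
transitivity (p@_m * \sum_(f in family Q) \prod_i f i ^+ e i).
  rewrite mulr_sumr; apply: eq_bigr => f _; rewrite mulrCA; congr (_ * _).
  under [RHS]eq_bigr do rewrite exprD.
  rewrite big_split /=; congr (_ * _).
    by rewrite [LHS]big_mkcond; apply: eq_bigr => i _; case: (i \in _).
  rewrite (partition_big sigma predT) //=; apply: eq_bigr => i _.
  by rewrite -prodrXr; apply: eq_bigr => j /eqP ->.
(* Otherwise each of the [#|B| - 1] free coordinates would have degree at least q - 2 in [m],
   exceeding [d]. The extra factor then makes the exponent of [i] lie strictly between 0 and q -
   1. *)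
have [i iB mi] : exists2 i, i \in B :\ i0 & (\sum_(j | sigma j == i) m j < #|K|.-1.-1)%N.
  apply/exists_inP; apply: contraLR dlt => /exists_inPn h.
  rewrite -leqNgt -(dhomogP _ _ _ hp m mp) mulnC -sum_nat_const.
  apply: (@leq_trans (\sum_(i in B :\ i0) \sum_(j | sigma j == i) m j)).
    by apply: leq_sum => i /h; rewrite -leqNgt.
  rewrite /= mdegE [X in (_ <= X)%N](partition_big sigma predT) //=.
  by rewrite [X in (_ <= X)%N](bigID (mem (B :\ i0))) leq_addr.
rewrite -(bigA_distr_big_dep Q (fun i y => y ^+ e i)) (bigD1 i) //= {1}/Q iB.
rewrite sum_units_expr ?mul0r ?mulr0 // /e iB addSn add0n /=.
by rewrite -ltn_predRL.
Qed.

(** [X] collects chosen coordinate vectors of the points. The hypothesis lets each monomial of the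
    indicator function, whose degree is only known modulo [#|K|.-1], be replaced by one of degree
    exactly [d]. *)
Lemma interpolates_of_monomials (s d : nat) (Z : {set proj_space K s})
    (X : 'rV[K]_s -> Prop) : (0 < s)%N ->
  (forall P, P \in Z -> exists2 x, X x & sval P = hclass x) ->
  (forall x, X x -> forall i, x 0 i != 0) ->
  (forall m : 'I_s -> nat, (\sum_i m i = d %[mod #|K|.-1])%N ->
     exists m' : 'I_s -> nat, (\sum_i m' i = d)%N /\
       forall x, X x -> \prod_i x 0 i ^+ m i = \prod_i x 0 i ^+ m' i) ->
  interpolates Z d.
Proof.
move=> s0 hZ X0 hm P PZ; set N := #|K|.-1 in hm.
have N0 : (0 < N)%N := finField_card_pred_gt0 K.
have [x0 Xx0 eP] := hZ P PZ; pose i0 := Ordinal s0.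
(* The interpolating polynomial has the values
   [x_i0 ^ d * \prod_i \sum_(j < N) u_i ^ j], where
   [u_i = x_i x_i0 ^ (N-1) r_i] is the ratio of [x_i / x_i0] to its value at [x0],
   as [x_i0 ^ (N-1)] is the inverse of [x_i0]. *)
pose r i := (x0 0 i)^-1 * x0 0 i0.
pose w (J : {ffun 'I_s -> 'I_N}) : nat := (d + N.-1 * \sum_i J i)%N.
pose m (J : {ffun 'I_s -> 'I_N}) i := (J i + (if i == i0 then w J else 0))%N.
have mE J x : \prod_i x 0 i ^+ m J i = \prod_i x 0 i ^+ J i * x 0 i0 ^+ w J :> K.
  under eq_bigr do rewrite exprD.
  rewrite big_split /=; congr (_ * _).
  by rewrite (bigD1 i0) // eqxx big1 /= ?mulr1 // => i /negPf ->.
have hmJ J : (\sum_i m J i = d %[mod N])%N.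
  rewrite big_split /= -big_mkcond /= big_pred1_eq /w addnCA -mulSn prednK //.
  by rewrite mulnC addnC modnMDl.
have [m' m'P] := fin_all_exists (fun J => hm (m J) (hmJ J)).
pose p := \sum_(J : {ffun 'I_s -> 'I_N}) (\prod_i r i ^+ J i) *: 'X_[[multinom m' J i | i < s]] : {mpoly K[s]}.
have pE x : X x -> p.@[fun i => x 0 i] =
    x 0 i0 ^+ d * \prod_i \sum_(j < N) (x 0 i * x 0 i0 ^+ N.-1 * r i) ^+ j.
  move=> Xx; rewrite bigA_distr_bigA mulr_sumr raddf_sum /=.
  apply: eq_bigr => J _; rewrite mevalZ mevalX.
  under [X in _ * X = _]eq_bigr do rewrite mnmE.
  have [_ /(_ x Xx) <-] := m'P J; rewrite mE.
  under [X in _ = _ * X]eq_bigr do rewrite exprMn exprMn -exprM.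
  rewrite !big_split /= prodrXr /w -big_distrr /= exprD.
  by ring.
have p_homog : p \is d.-homog.
  apply: rpred_sum => J _; apply: rpredZ; rewrite dhomogX /= mdegE.
  by under eq_bigr do rewrite mnmE; have [-> _] := m'P J.
exists p; split=> // [y yP | Q QZ QP y yQ].
  apply/eqP => py0.
  have : p.@[fun i => x0 0 i] = 0.
    apply: homog_vanish_class p_homog _ py0; move: yP.
    rewrite eP => /imsetP[c c0 ->]; rewrite inE in c0; apply/imsetP.
    by exists c^-1; rewrite ?inE ?invr_eq0 // scalerA mulVf ?scale1r.
  rewrite pE // => /eqP; rewrite mulf_eq0 expf_eq0 (negPf (X0 _ Xx0 _)) andbF /=.
  apply/negP/prodf_neq0 => i _.
  (* At [x0] all ratios are 1, so each geometric sum equals [N], which is nonzero in [K]. *)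
  rewrite (_ : _ * r i = 1); last first.
    rewrite /r mulrCA !mulrA mulVf ?X0 // mul1r -exprSr prednK //.
    exact: expf_card_pred (X0 _ Xx0 _).
  under eq_bigr do rewrite expr1n.
  by rewrite sumr_const card_ord natr_card_pred_neq0.
have [x Xx eQ] := hZ Q QZ.
rewrite eQ in yQ; apply: homog_vanish_class p_homog yQ _.
rewrite pE //; apply/eqP; rewrite mulf_eq0; apply/orP; right.
(* A single ratio other than 1 kills its geometric sum. If all ratios were 1, [x] would be a
   multiple of [x0] and [Q] would equal [P]. *)
suff [i ri] : exists i, x 0 i * x 0 i0 ^+ N.-1 * r i != 1.
  apply/prodf_eq0; exists i => //; apply/eqP/sum_geometric => //.
  by rewrite /r !mulf_neq0 ?invr_eq0 ?expf_neq0 ?X0.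
apply/existsP; apply: contraR QP => /existsPn h.
have rX i : x 0 i = x 0 i0 / x0 0 i0 * x0 0 i.
  have := h i; rewrite negbK => /eqP e1.
  have b0 := X0 _ Xx0.
  have eN : x 0 i0 ^+ N.-1 * x 0 i0 = 1.
    by rewrite -exprSr prednK ?expf_card_pred ?X0.
  rewrite -[LHS]mulr1 -eN -[RHS]mulr1 -e1 /r; set t := _ ^+ _.
  by field; rewrite !b0.
have xE : x = (x 0 i0 / x0 0 i0) *: x0 by apply/rowP => i; rewrite mxE.
have c0 : x 0 i0 / x0 0 i0 != 0 by rewrite mulf_neq0 ?invr_eq0 ?X0.
apply/eqP/val_inj; rewrite /= eQ eP; apply/setP => y'.
apply/imsetP/imsetP => -[c]; rewrite inE => cn0 ->.
  exists (c * (x 0 i0 / x0 0 i0)); first by rewrite inE mulf_neq0.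
  by rewrite {1}xE scalerA.
exists (c / (x 0 i0 / x0 0 i0)); first by rewrite inE mulf_neq0 ?invr_eq0.
by rewrite {2}xE scalerA divfK.
Qed.

End Bounds.

(** * Adjusting exponents modulo [N] to a prescribed total degree *)

Section Exponents.

(** A sum above [d] and congruent to it would be at least [d + N]. So the sum is at most [d], and
    the deficit, a multiple of [N], can be added at [i0]. *)
Lemma exponents_raise (I : finType) (A : pred I) (i0 : I) (N d : nat)
    (alpha : I -> nat) :
  A i0 -> 0 < N -> \sum_(i | A i) alpha i = d %[mod N] ->
  \sum_(i | A i) alpha i <= d + N.-1 ->
  exists beta : I -> nat,
    (forall i, beta i = alpha i %[mod N]) /\ \sum_(i | A i) beta i = d.
Proof.
move=> Ai0 N0; set S := \sum_(i | A i) _ => eS leS.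
have Sd : S <= d.
  rewrite leqNgt; apply/negP => dS.
  have /dvdnP[c hc] : N %| S - d by rewrite -eqn_mod_dvd ?(ltnW dS) //; apply/eqP.
  case: c hc => [|c]; first lia.
  rewrite mulSn; lia.
have /dvdnP[c hc] : N %| d - S by rewrite -eqn_mod_dvd //; apply/eqP.
exists (fun i => (if i == i0 then d - S else 0) + alpha i); split=> [i|].
  by case: eqP => // _; rewrite hc modnMDl.
rewrite big_split /= -big_mkcondr /= (big_pred1 i0) => [|i]; first exact: subnK.
by rewrite /= andbC; case: eqP => //= ->.
Qed.

Lemma exponents_reduce (I : finType) (A : pred I) (N d : nat)
    (alpha : I -> nat) :
  0 < #|A| -> 0 < N -> N.-1 * (#|A| - 1) <= d ->
  \sum_(i | A i) alpha i = d %[mod N] ->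
  exists beta : I -> nat,
    (forall i, beta i = alpha i %[mod N]) /\ \sum_(i | A i) beta i = d.
Proof.
move=> A0 N0 hd eS; have /card_gt0P[i0 Ai0] := A0.
have [||beta [hb sb]] :=
  @exponents_raise I A i0 N d (fun i => alpha i %% N) Ai0 N0.
- by rewrite modn_summ.
- apply: (@leq_trans (\sum_(i in A) N.-1)).
    by apply: leq_sum => i _; rewrite -ltnS prednK // ltn_pmod.
  rewrite sum_nat_const mulnC; move: A0 hd; case: #|A| => // n _.
  by rewrite subn1 mulnS addnC leq_add2r.
by exists beta; split=> // i; rewrite hb modn_mod.
Qed.

(** The residues of [f] run through 0, ..., N - 1 once each; the factor 2 avoids halving. *)
Lemma sum_ord_modn (N : nat) (f : nat -> nat) :
  0 < N -> {in gtn N &, forall i j, f i = f j %[mod N] -> i = j} ->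
  2 * \sum_(j < N) f j %% N = N * N.-1.
Proof.
move=> N0 inj.
pose h (j : 'I_N) := Ordinal (ltn_pmod (f j) N0).
have hI : injective h.
  by move=> i j /(congr1 val) /= /inj E; apply/val_inj/E; exact: ltn_ord.
transitivity (2 * \sum_(j < N) j); first by rewrite [in RHS](reindex_inj hI).
elim: N {N0 f inj h hI} => [|N IH]; first by rewrite big_ord0.
by rewrite big_ord_recr /= mulnDr IH; case: N {IH} => //= N; lia.
Qed.

End Exponents.

(** * Existence of the regularity index and its value for the torus *)

Section Regularity.
Local Open Scope ring_scope.
Variable K : finFieldType.

Lemma expf_modn (x : K) (a b : nat) :
  x != 0 -> (a = b %[mod #|K|.-1])%N -> x ^+ a = x ^+ b.
Proof.
move=> x0 ab; have E c : x ^+ c = x ^+ (c %% #|K|.-1).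
  by rewrite {1}(divn_eq c #|K|.-1) exprD mulnC exprM expf_card_pred // expr1n mul1r.
by rewrite E ab -E.
Qed.

(** Stated for any subset of the torus: it gives the upper bound for the torus itself and, for toric
    sets, some degree in which interpolation holds. *)
Lemma interpolates_torus_points (s d : nat) (Z : {set proj_space K s}) :
  (0 < s)%N -> ((#|K| - 2) * (s - 1) <= d)%N ->
  (forall P, P \in Z ->
     exists2 x : 'rV[K]_s, (forall i, x 0 i != 0) & sval P = hclass x) ->
  interpolates Z d.
Proof.
move=> s0 hd hZ.
apply: (@interpolates_of_monomials _ _ _ _ (fun x => forall i, x 0 i != 0)) => //.
move=> m hm; have [|||m' [mm' sm']] :=
  @exponents_reduce 'I_s predT #|K|.-1 d m _ _ _ hm.
- by rewrite card_ord.
- exact: finField_card_pred_gt0.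
- by rewrite card_ord; move: hd; rewrite subn2.
by exists m'; split=> // x x0; apply: eq_bigr => i _; apply: expf_modn.
Qed.

(** Descends to a least degree; the case split on a smaller one is classical because [interpolates]
    is a proposition. *)
Lemma regularity_index_exists (s d : nat) (Z : {set proj_space K s}) :
  interpolates Z d -> exists m, regularity_index Z m.
Proof.
elim/ltn_ind: d => d IH hd.
have [[d' lt_d' hd']|noless] :=
  classic (exists2 d', (d' < d)%N & interpolates Z d').
  exact: IH hd'.
exists d; split=> [|d' /hilbert_value_card hd']; first exact/hilbert_value_card.
by rewrite leqNgt; apply/negP => ?; apply: noless; exists d'.
Qed.

Lemma regularity_indexI (s d : nat) (Z : {set proj_space K s}) :
  interpolates Z d -> (forall d', interpolates Z d' -> (d <= d')%N) ->
  regularity_index Z d.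
Proof.
by move=> hd le_d; split=> [|d' /hilbert_value_card /le_d]; first exact/hilbert_value_card.
Qed.

Lemma hclass_ppoint (s : nat) (x : 'rV[K]_s) : (0 < s)%N ->
  (forall i, x 0 i != 0) -> exists P : proj_space K s, sval P = hclass x.
Proof.
move=> s0 x0; have hP : is_ppoint (hclass x).
  apply/existsP; exists x; rewrite eqxx andbT.
  by apply: contraNneq (x0 (Ordinal s0)) => ->; rewrite mxE.
by exists (exist (fun P => is_ppoint P) (hclass x) hP).
Qed.

Lemma regularity_index_torus (k : nat) : (0 < k)%N ->
  regularity_index (proj_torus K k) ((#|K| - 2) * (k - 1)).
Proof.
move=> k0; apply: regularity_indexI => [|d].
  apply: interpolates_torus_points => // P; rewrite inE.
  by case/existsP => t /andP[/forallP t0 /eqP ->]; exists t.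
move=> hI; have := @interpolates_lower_bound _ _ _ _ _ id _ hI.
rewrite card_imset ?card_ord; last exact: inj_id.
apply=> x x0.
have x0' i : (\row_j x j) 0 i != 0 by rewrite mxE.
have [P eP] := hclass_ppoint k0 x0'; exists P => //.
by rewrite inE; apply/existsP; exists (\row_j x j); rewrite eP eqxx andbT; apply/forallP.
Qed.

End Regularity.

(** * Edges, matchings and bipartitions *)

Section Graphs.

Lemma edgesP (G : sgraph) (E : {set G}) :
  reflect (exists2 p : G * G, adj p.1 p.2 & E = [set p.1; p.2]) (E \in edges G).
Proof. by apply: (iffP imsetP) => -[p]; rewrite ?inE; exists p; rewrite ?inE. Qed.

Lemma adj_neq (G : sgraph) (u v : G) : adj u v -> u != v.
Proof. by apply: contraTneq => ->; rewrite adj_irr. Qed.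

Lemma big_edges (R : Type) (idx : R) (op : Monoid.com_law idx) (G : sgraph)
    (s : nat) (e : s.-tuple {set G}) (Q : pred {set G}) (F : {set G} -> R) :
  edge_enumeration e ->
  \big[op/idx]_(i < s | Q (tnth e i)) F (tnth e i) =
  \big[op/idx]_(E in edges G | Q E) F E.
Proof.
move=> [ue he]; rewrite big_mkcond [RHS]big_mkcondr.
rewrite -(big_tuple _ _ e predT (fun E => if Q E then F E else idx)).
by rewrite big_uniq //=; apply: eq_bigl => E; rewrite he.
Qed.

Lemma card_matching (G : sgraph) (M : {set {set G}}) :
  M \subset edges G -> partition M [set: G] -> #|G| = #|M| * 2.
Proof.
move=> sM pM; rewrite -cardsT; apply: card_uniform_partition pM => E EM.
by have /edgesP[p /adj_neq pn ->] := subsetP sM _ EM; rewrite cards2 pn.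
Qed.

Lemma involution_block (T : finType) (mu : T -> T) (x y : T) :
  involutive mu -> y \in [set x; mu x] -> [set x; mu x] = [set y; mu y].
Proof. by move=> muK /set2P[] -> //; rewrite muK setUC. Qed.

Lemma involution_matching (G : sgraph) (mu : G -> G) :
  involutive mu -> (forall x, adj x (mu x)) ->
  let M := [set [set x; mu x] | x : G] in
  M \subset edges G /\ partition M [set: G].
Proof.
move=> muK hmu M; split.
  apply/subsetP => E /imsetP[x _ ->]; apply/edgesP.
  by exists (x, mu x).
have inM x y := @involution_block _ mu x y muK.
apply/and3P; split.
- rewrite eqEsubset subsetT; apply/subsetP => x _; apply/bigcupP.
  by exists [set x; mu x]; rewrite ?set21 //; apply/imsetP; exists x.
- apply/trivIsetP => _ _ /imsetP[x _ ->] /imsetP[y _ ->].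
  apply: contraR => /pred0Pn[z /= /andP[/inM -> /inM ->]].
  by rewrite eqxx.
- by apply/imsetP => -[x _ /setP/(_ x)]; rewrite !inE eqxx.
Qed.

Lemma bipartite_edge_ends (G : sgraph) (A : {set G}) (s : nat)
    (e : s.-tuple {set G}) :
  (forall x y, adj x y -> (x \in A) != (y \in A)) -> edge_enumeration e ->
  exists ends : 'I_s -> G * G, forall i,
    [/\ tnth e i = [set (ends i).1; (ends i).2], adj (ends i).1 (ends i).2,
        (ends i).1 \in A & (ends i).2 \notin A].
Proof.
move=> hA [_ he]; apply: (fin_all_exists (P := fun i p =>
  [/\ tnth e i = [set p.1; p.2], adj p.1 p.2, p.1 \in A & p.2 \notin A])) => i.
have /edgesP[[u v] /= uv ->] : tnth e i \in edges G by rewrite -he mem_tnth.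
have := hA _ _ uv; have [uA|uA] := boolP (u \in A).
  by case: (boolP (v \in A)) => // vA _; exists (u, v).
case: (boolP (v \in A)) => // vA _; exists (v, u) => /=.
by rewrite adj_sym setUC.
Qed.

(** Each edge of a perfect matching has exactly one end outside [A]. *)
Lemma card_bipartition (G : sgraph) (A : {set G}) (k : nat) :
  (forall x y, adj x y -> (x \in A) != (y \in A)) -> has_perfect_matching G ->
  #|G| = 2 * k -> #|~: A| = k.
Proof.
move=> hA [M [sM pM]]; rewrite (card_matching sM pM) mulnC.
move=> /eqP; rewrite eqn_mul2l /= => /eqP <-.
have /and3P[/eqP cM tM _] := pM.
rewrite -sum1_card big_mkcond /=.
rewrite (eq_bigl (fun v => v \in cover M)) => [|v]; last by rewrite cM inE.
rewrite (big_trivIset _ tM) -sum1_card /=; apply: eq_bigr => E EM.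
have /edgesP[[u v] /= uv ->] := subsetP sM _ EM.
rewrite big_setU1 ?inE ?adj_neq // big_set1 !inE.
by have := hA _ _ uv; case: (u \in A); case: (v \in A).
Qed.

End Graphs.

(** * Interpolation on toric sets of graphs *)

Section ToricSets.
Local Open Scope ring_scope.
Variable K : finFieldType.

Lemma toric_set_rep (G : sgraph) (s : nat) (e : s.-tuple {set G}) P :
  P \in toric_set K e ->
  exists2 x, (exists2 t : {ffun G -> K}, (forall v, t v != 0) & x = edge_monomials e t)
    & sval P = hclass x.
Proof.
rewrite inE => /existsP[t /andP[/forallP t0 /eqP eP]].
by exists (edge_monomials e t) => //; exists t.
Qed.

Lemma edge_monomials_neq0 (G : sgraph) (s : nat) (e : s.-tuple {set G})
    (t : {ffun G -> K}) i :
  (forall v, t v != 0) -> edge_monomials e t 0 i != 0.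
Proof. by move=> t0; rewrite mxE; apply/prodf_neq0 => v _. Qed.

Lemma toric_set_mem (G : sgraph) (s : nat) (e : s.-tuple {set G})
    (t : {ffun G -> K}) : (0 < s)%N -> (forall v, t v != 0) ->
  exists2 P, P \in toric_set K e & sval P = hclass (edge_monomials e t).
Proof.
move=> s0 t0.
have [P eP] := hclass_ppoint s0 (fun i => edge_monomials_neq0 e i t0).
exists P => //; rewrite inE; apply/existsP; exists t.
by rewrite eP eqxx andbT; apply/forallP.
Qed.

Lemma edge_monomial_ends (G : sgraph) (s : nat) (e : s.-tuple {set G})
    (t : {ffun G -> K}) i (u v : G) :
  u != v -> tnth e i = [set u; v] -> edge_monomials e t 0 i = t u * t v.
Proof. by move=> uv E; rewrite mxE E big_setU1 ?inE // big_set1. Qed.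

Lemma edge_number_gt0 (G : sgraph) (s : nat) (e : s.-tuple {set G}) :
  (0 < #|G|)%N -> has_perfect_matching G -> edge_enumeration e -> (0 < s)%N.
Proof.
move=> /card_gt0P[v _] [M [sM /and3P[/eqP cM _ _]]] [_ he].
have : v \in cover M by rewrite cM inE.
case/bigcupP => E /(subsetP sM); rewrite -he => /tnthP[i _] _.
by apply: leq_ltn_trans (ltn_ord i).
Qed.

Lemma interpolates_toric_lower_bound (G : sgraph) (k s d : nat)
    (e : s.-tuple {set G}) :
  #|G| = (2 * k)%N -> bipartite G -> has_perfect_matching G ->
  edge_enumeration e -> interpolates (toric_set K e) d ->
  ((#|K| - 2) * (k - 1) <= d)%N.
Proof.
move=> cG [A hA] hM he hI.
have [->|k0] := posnP k; first by rewrite muln0.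
have s0 : (0 < s)%N by apply: edge_number_gt0 he => //; rewrite cG muln_gt0.
have [ends hends] := bipartite_edge_ends hA he.
(* The matching covers every vertex, so each vertex outside [A] is the end of some edge. *)
have imB : [set (ends j).2 | j in 'I_s] = ~: A.
  apply/setP => v; rewrite inE; apply/imsetP/idP => [[j _ ->]|vA].
    by have [] := hends j.
  have [M [sM /and3P[/eqP cM _ _]]] := hM.
  have : v \in cover M by rewrite cM inE.
  case/bigcupP => E /(subsetP sM); rewrite -he.2 => /tnthP[i ->].
  have [-> _ uA _] := hends i; case/set2P => Ev; last by exists i.
  by rewrite Ev uA in vA.
rewrite -(card_bipartition hA hM cG) -imB.
apply: interpolates_lower_bound hI => x x0.
pose t := [ffun v => if v \in A then 1 else x v].
have t0 v : t v != 0 by rewrite ffunE; case: ifP => // _; rewrite oner_neq0.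
have [P PZ eP] := toric_set_mem e s0 t0; exists P => //.
rewrite eP; congr hclass; apply/rowP => i.
have [E /adj_neq uv uA vA] := hends i.
by rewrite (edge_monomial_ends _ uv E) !mxE !ffunE uA (negPf vA) mul1r.
Qed.

Lemma interpolates_toric_of_monomials (G : sgraph) (s d : nat)
    (e : s.-tuple {set G}) : (0 < s)%N ->
  (forall m : 'I_s -> nat, (\sum_i m i = d %[mod #|K|.-1])%N ->
     exists m' : 'I_s -> nat, (\sum_i m' i = d)%N /\
       forall t : {ffun G -> K}, (forall v, t v != 0) ->
       \prod_i edge_monomials e t 0 i ^+ m i =
       \prod_i edge_monomials e t 0 i ^+ m' i) ->
  interpolates (toric_set K e) d.
Proof.
move=> s0 hm; apply: (@interpolates_of_monomials _ _ _ _ (fun x =>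
  exists2 t : {ffun G -> K}, (forall v, t v != 0) & x = edge_monomials e t)) => //.
- exact: toric_set_rep.
- by move=> _ [t t0 ->] i; exact: edge_monomials_neq0.
move=> m /hm[m' [sm' hm']]; exists m'; split=> // _ [t t0 ->].
exact: hm'.
Qed.

(* Multiplying by a power of the relation between the two matchings shifts the
   exponents on [M1] up and those on [M2] down; the average over all shifts of
   the reduced total degree is [k * (q - 2)]. *)
Lemma interpolates_toric_two_matchings (G : sgraph) (k s : nat)
    (e : s.-tuple {set G}) (M1 M2 : {set {set G}}) :
  (0 < k)%N -> #|G| = (2 * k)%N -> edge_enumeration e ->
  partition M1 [set: G] -> partition M2 [set: G] ->
  edges G = M1 :|: M2 -> [disjoint M1 & M2] ->
  interpolates (toric_set K e) ((#|K| - 2) * (k - 1)).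
Proof.
move=> k0 cG he p1 p2 eM dM; set N := #|K|.-1.
have N0 : (0 < N)%N := finField_card_pred_gt0 K.
have -> : (#|K| - 2 = N.-1)%N by rewrite subn2.
have s1 : M1 \subset edges G by rewrite eM subsetUl.
have s2 : M2 \subset edges G by rewrite eM subsetUr.
have c1 : #|M1| = k by apply/eqP; rewrite -(eqn_pmul2r (isT : 0 < 2)%N) -(card_matching s1 p1) cG mulnC.
have c2 : #|M2| = k by apply/eqP; rewrite -(eqn_pmul2r (isT : 0 < 2)%N) -(card_matching s2 p2) cG mulnC.
have inM2 i : (tnth e i \notin M1) = (tnth e i \in M2).
  have : tnth e i \in edges G by rewrite -he.2 mem_tnth.
  rewrite eM inE; have [iM1 _|] := boolP (tnth e i \in M1); last by move=> _ /= ->.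
  by rewrite (disjointFr dM iM1).
have bigM (R : Type) (idx : R) (op : Monoid.com_law idx) (M : {set {set G}}) F :
    M \subset edges G ->
    \big[op/idx]_(i < s | tnth e i \in M) F (tnth e i) = \big[op/idx]_(E in M) F E.
  move=> sM; rewrite (big_edges op (mem M) F he); apply: eq_bigl => E.
  by rewrite andb_idl // => /(subsetP sM).
have cI1 : (\sum_(i < s | tnth e i \in M1) 1 = k)%N.
  by rewrite (bigM _ _ _ _ (fun=> 1%N)) // sum1_card.
have cI2 : (\sum_(i < s | tnth e i \in M2) 1 = k)%N.
  by rewrite (bigM _ _ _ _ (fun=> 1%N)) // sum1_card.
have split_sum (F : 'I_s -> nat) : (\sum_i F i =
    \sum_(i | tnth e i \in M1) F i + \sum_(i | tnth e i \in M2) F i)%N.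
  rewrite (bigID (fun i => tnth e i \in M1)) /=; congr (_ + _)%N.
  by apply: eq_bigl => i; rewrite inM2.
have cs : s = (2 * k)%N.
  by rewrite -[LHS]card_ord -sum1_card split_sum cI1 cI2 mul2n addnn.
have s0 : (0 < s)%N by rewrite cs muln_gt0.
apply: interpolates_toric_of_monomials => // m hm.
(* [N - j] stands for the shift by -j modulo [N], keeping exponents natural. *)
pose sh (j : nat) i := (m i + (if tnth e i \in M1 then j else N - j))%N.
have shE i : (2 * \sum_(j < N) sh j i %% N = N * N.-1)%N.
  apply: (sum_ord_modn (f := fun j => sh j i)) => // j j' jN j'N; rewrite !inE in jN j'N.
  rewrite /sh; move/eqP; rewrite eqn_modDl; case: ifP => _ /eqP.
    by rewrite !modn_small.
  move/eqP; rewrite -(eqn_modDr (j + j')) => /eqP.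
  have -> : (N - j + (j + j') = N + j')%N by lia.
  have -> : (N - j' + (j + j') = N + j)%N by lia.
  by rewrite !modnDl !modn_small.
(* Each of the 2k coordinates contributes N(N - 1)/2 over all shifts, so some shift is at most the
   average k(N - 1). *)
have [j lej] : exists j : 'I_N, (\sum_i sh j i %% N <= k * N.-1)%N.
  apply/existsP; apply: contraT => /existsPn h.
  have : (\sum_(j < N) (k * N.-1).+1 <= \sum_(j < N) \sum_i sh j i %% N)%N.
    by apply: leq_sum => j _; rewrite ltnNge.
  rewrite sum_nat_const card_ord exchange_big /= -(leq_pmul2l (isT : 0 < 2)%N).
  rewrite big_distrr /=; under eq_bigr do rewrite shE.
  rewrite sum_nat_const card_ord cs; nia.
have shS : (\sum_i sh j i = \sum_i m i + N * k)%N.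
  rewrite big_split /=; congr (_ + _)%N; rewrite split_sum.
  rewrite (eq_bigr (fun=> (j * 1)%N)) => [|i ->]; last by rewrite muln1.
  rewrite [X in (_ + X)%N](eq_bigr (fun=> ((N - j) * 1)%N)) => [|i]; last first.
    by rewrite -inM2 => /negPf ->; rewrite muln1.
  by rewrite -!big_distrr /= cI1 cI2 -mulnDl subnKC // ltnW.
have [||m' [mm' sm']] := @exponents_raise _ predT (Ordinal s0) N
    (N.-1 * (k - 1)) (fun i => sh j i %% N)%N isT N0.
- by rewrite modn_summ shS mulnC addnC modnMDl.
- by apply: leq_trans lej _; rewrite mulnBr muln1 mulnC subnK // leq_pmulr.
exists m'; split=> // t t0; pose x i := edge_monomials e t 0 i.
have x0 i : x i != 0 by apply: edge_monomials_neq0.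
(* A perfect matching meets each vertex once, so both matchings give the product of all [t v]; the
   shift multiplies the monomial by the [N]-th power of this product, which is 1. *)
have prodM (M : {set {set G}}) : M \subset edges G -> partition M [set: G] ->
    \prod_(i < s | tnth e i \in M) x i = \prod_v t v.
  move=> sM /and3P[/eqP cM tM _].
  have xE i : x i = \prod_(v in tnth e i) t v by rewrite /x mxE.
  rewrite (eq_bigr _ (fun i _ => xE i)).
  rewrite (bigM _ _ _ M (fun E => \prod_(v in E) t v)) //.
  by rewrite -(big_trivIset _ tM) cM; apply: eq_bigl => v; rewrite inE.
rewrite -!/(x _); transitivity (\prod_i x i ^+ sh j i); last first.
  by apply: eq_bigr => i _; apply: expf_modn => //; rewrite mm' modn_mod.
under [RHS]eq_bigr do rewrite exprD.
rewrite big_split /= [X in _ = _ * X](bigID (fun i => tnth e i \in M1)) /=.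
rewrite [X in _ * (X * _)](eq_bigr (fun i => x i ^+ j)) => [|i ->] //.
rewrite [X in _ * (_ * X)](eq_bigr (fun i => x i ^+ (N - j))) => [|i /negPf ->] //.
rewrite [X in _ * (_ * X)](eq_bigl _ _ inM2) !prodrXl !prodM //.
rewrite -exprD subnKC ?(ltnW (ltn_ord j)) // expf_card_pred ?mulr1 //.
exact/prodf_neq0.
Qed.

(* [m] is a multiset of edges [{a i, b i}] whose vertex degrees are [alpha] on
   [A] and [beta] off [A]; the products record these degrees. *)
Lemma degree_sequences_realizable (G : sgraph) (A : {set G}) (s d : nat)
    (a b : 'I_s -> G) (alpha beta : G -> nat) :
  (forall u v, u \in A -> v \notin A -> exists i, a i = u /\ b i = v) ->
  (\sum_(v in A) alpha v = d)%N -> (\sum_(v | v \notin A) beta v = d)%N ->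
  exists m : 'I_s -> nat, (\sum_i m i = d)%N /\
    forall t : G -> K, \prod_i (t (a i) * t (b i)) ^+ m i =
      \prod_(v in A) t v ^+ alpha v * \prod_(v | v \notin A) t v ^+ beta v.
Proof.
move=> hab; elim: d alpha beta => [|d IH] alpha beta.
  move=> /eqP; rewrite sum_nat_eq0 => /forall_inP ha.
  move=> /eqP; rewrite sum_nat_eq0 => /forall_inP hb.
  exists (fun=> 0%N); split=> [|t]; first by rewrite big1.
  by rewrite !big1 ?mulr1 // => v; [move/hb|move/ha] => /eqP ->.
(* Lowers the degree of one vertex by 1. Doing so on each side removes one edge, which exists
   because all pairs across the bipartition are joined. *)
have pick (P : pred G) (g : G -> nat) : (\sum_(v | P v) g v = d.+1)%N ->
    exists u, [/\ P u, (\sum_(v | P v) (g v - (v == u)) = d)%N &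
      forall t : G -> K, \prod_(v | P v) t v ^+ g v =
        t u * \prod_(v | P v) t v ^+ (g v - (v == u))].
  move=> sg; have [u Pu gu] : exists2 u, P u & (0 < g u)%N.
    apply/exists_inP; apply: contraPT sg => /exists_inPn h.
    by rewrite big1 // => v /h; rewrite lt0n negbK => /eqP.
  have other v : v != u -> (g v - (v == u) = g v)%N by move/negPf ->; rewrite subn0.
  exists u; split=> // [|t].
    move: sg; rewrite (bigD1 u) // [in X in _ -> X](bigD1 u) //= eqxx.
    rewrite [in X in _ -> X](eq_bigr g) => [|v /andP[_ /other]] //; lia.
  rewrite (bigD1 u) // [in RHS](bigD1 u) //= eqxx mulrA -exprS subn1 prednK //.
  by congr (_ * _); apply: eq_bigr => v /andP[_ /other ->].
move=> /pick[u [uA su tu]] /pick[w [wA sw tw]].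
have [i0 [ai0 bi0]] := hab _ _ uA wA.
have [m [sm hm]] := IH _ _ su sw.
exists (fun i => (i == i0) + m i)%N; split=> [|t].
  by rewrite big_split /= sm -big_mkcond /= big_pred1_eq.
under eq_bigr do rewrite exprD.
rewrite big_split /= hm tu tw (bigD1 i0) //= eqxx expr1 big1 => [|i /negPf ->] //.
by rewrite ai0 bi0 mulr1 mulrACA.
Qed.

(** A monomial on the toric set depends only on its vertex degrees. These are reduced separately on
    the two sides to the same total and then realised by edges. *)
Lemma interpolates_toric_complete (G : sgraph) (A : {set G}) (n s : nat)
    (e : s.-tuple {set G}) :
  (0 < n)%N -> #|A| = n -> #|~: A| = n ->
  (forall x y, adj x y = ((x \in A) != (y \in A))) -> edge_enumeration e ->
  interpolates (toric_set K e) ((#|K| - 2) * (n - 1)).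
Proof.
move=> n0 cA cB hadj he; set N := #|K|.-1.
have N0 : (0 < N)%N := finField_card_pred_gt0 K.
have hA (x y : G) : adj x y -> (x \in A) != (y \in A) by rewrite hadj.
have [ends hends] := bipartite_edge_ends hA he.
have uA i : (ends i).1 \in A by case: (hends i).
have vA i : (ends i).2 \notin A by case: (hends i).
have hab u v : u \in A -> v \notin A -> exists i, (ends i).1 = u /\ (ends i).2 = v.
  move=> uA' vA'; have : [set u; v] \in e.
    rewrite he.2; apply/edgesP; exists (u, v) => //=.
    by rewrite hadj uA' (negPf vA').
  case/tnthP => i E; exists i; have [E' _ _ _] := hends i; rewrite E' in E.
  have := set21 (ends i).1 (ends i).2; have := set22 (ends i).1 (ends i).2.
  rewrite -E => /set2P[] Ev /set2P[] Eu //.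
  - by have := vA i; rewrite Ev uA'.
  - by have := vA i; rewrite Ev uA'.
  - by have := uA i; rewrite Eu (negPf vA').
have /card_gt0P[u0 u0A] : (0 < #|A|)%N by rewrite cA.
have /card_gt0P[v0 v0A] : (0 < #|~: A|)%N by rewrite cB.
rewrite inE in v0A; have [i0 _] := hab _ _ u0A v0A.
have s0 : (0 < s)%N by apply: leq_ltn_trans (ltn_ord i0).
apply: interpolates_toric_of_monomials => // m hm.
have cB' : #|[pred v | v \notin A]| = n by rewrite -cB; apply: eq_card => v; rewrite !inE.
have sumA : (\sum_i m i = \sum_(v in A) \sum_(i | (ends i).1 == v) m i)%N.
  by rewrite (partition_big (fun i => (ends i).1) (mem A)) /=.
have sumB : (\sum_i m i = \sum_(v | v \notin A) \sum_(i | (ends i).2 == v) m i)%N.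
  by rewrite (partition_big (fun i => (ends i).2) (fun v => v \notin A)) /=.
have [||||al [mal sal]] := @exponents_reduce _ (mem A) N
    ((#|K| - 2) * (n - 1)) (fun v => \sum_(i | (ends i).1 == v) m i)%N.
- by rewrite cA.
- by [].
- by rewrite cA /N subn2.
- by rewrite -sumA.
have [||||be [mbe sbe]] := @exponents_reduce _ [pred v | v \notin A] N
    ((#|K| - 2) * (n - 1)) (fun v => \sum_(i | (ends i).2 == v) m i)%N.
- by rewrite cB'.
- by [].
- by rewrite cB' /N subn2.
- by rewrite -sumB.
have [m' [sm' hm']] := degree_sequences_realizable hab sal sbe.
exists m'; split=> // t t0.
have xE i : edge_monomials e t 0 i = t (ends i).1 * t (ends i).2.
  by have [E /adj_neq uv _ _] := hends i; exact: edge_monomial_ends.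
under eq_bigr do rewrite xE; under [RHS]eq_bigr do rewrite xE.
rewrite hm'; under eq_bigr do rewrite exprMn.
rewrite big_split /=; congr (_ * _).
  rewrite (partition_big (fun i => (ends i).1) (mem A)) //=.
  apply: eq_bigr => v _; rewrite (expf_modn (t0 v) (mal v)) -prodrXr.
  by apply: eq_bigr => i /eqP ->.
rewrite (partition_big (fun i => (ends i).2) (fun v => v \notin A)) //=.
apply: eq_bigr => v _; rewrite (expf_modn (t0 v) (mbe v)) -prodrXr.
by apply: eq_bigr => i /eqP ->.
Qed.

End ToricSets.

(** * The two perfect matchings of an even cycle *)

Section Cycles.

Lemma odd_ordS (n : nat) (i : 'I_n) : ~~ odd n -> odd (ordS i) = ~~ odd i.
Proof. by move=> /negbTE en; rewrite /= odd_mod. Qed.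

(* The two perfect matchings of an even cycle: [b] is the parity of the vertices
   that are matched with their successor. *)
Definition cycle_partner (n : nat) (b : bool) (i : 'I_n) : 'I_n :=
  if odd i == b then ordS i else ord_pred i.

Lemma odd_cycle_partner (n : nat) (b : bool) (i : 'I_n) :
  ~~ odd n -> odd (cycle_partner b i) = ~~ odd i.
Proof.
move=> en; rewrite /cycle_partner; case: ifP => _; first exact: odd_ordS.
by rewrite -[in RHS](ord_predK i) odd_ordS ?negbK.
Qed.

Lemma cycle_partnerK (n : nat) (b : bool) :
  ~~ odd n -> involutive (@cycle_partner n b).
Proof.
move=> en i; rewrite {1}/cycle_partner odd_cycle_partner // /cycle_partner.
by case: (odd i); case: b => /=; rewrite ?ordSK ?ord_predK.
Qed.

Lemma cycle_partner_rel (n : nat) (b : bool) (i : 'I_n) :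
  ~~ odd n -> cycle_rel i (cycle_partner b i).
Proof.
move=> en; apply/andP; split.
  apply: contraTneq isT => /(congr1 (fun j : 'I_n => odd j)).
  by rewrite odd_cycle_partner //; case: odd.
by rewrite /cycle_partner; case: ifP => _; rewrite ?ord_predK eqxx ?orbT.
Qed.

Lemma cycle_relP (n : nat) (i j : 'I_n) :
  cycle_rel i j -> j = cycle_partner true i \/ j = cycle_partner false i.
Proof.
rewrite /cycle_partner => /andP[_ /orP[] /eqP E].
  by rewrite -E; case: (odd i) => /=; [left | right].
by rewrite -E ordSK; case: (odd _) => /=; [right | left].
Qed.

(** Successor and predecessor coincide only if 2 is 0 modulo [n]. *)
Lemma cycle_partner_neq (n : nat) (i : 'I_n) :
  2 < n -> cycle_partner true i != cycle_partner false i.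
Proof.
move=> n2; have SP : ordS i != ord_pred i.
  apply/eqP => /(congr1 (@ordS n)); rewrite ord_predK => /(congr1 val) /=.
  rewrite -addn1 modnDml addn1 -[RHS](modn_small (ltn_ord i)) => /eqP.
  rewrite -{2}[val i]addn0 -addn2 /= eqn_modDl mod0n modn_small //.
by rewrite /cycle_partner; case: (odd i) => //=; rewrite eq_sym.
Qed.

End Cycles.

(** * Tightness for even cycles and balanced complete bipartite graphs *)

Section Families.
Variable K : finFieldType.

Lemma regularity_index_toric_tight (G : sgraph) (k s : nat)
    (e : s.-tuple {set G}) :
  0 < k -> #|G| = 2 * k -> bipartite G -> has_perfect_matching G ->
  edge_enumeration e -> interpolates (toric_set K e) ((#|K| - 2) * (k - 1)) ->
  exists r : nat, regularity_index (toric_set K e) r /\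
                  regularity_index (proj_torus K k) r.
Proof.
move=> k0 cG bG mG he hI; exists ((#|K| - 2) * (k - 1)); split.
  apply: regularity_indexI => // d.
  exact: interpolates_toric_lower_bound cG bG mG he.
exact: regularity_index_torus.
Qed.

Lemma even_cycle_regularity (k : nat) (G : sgraph) (s : nat)
    (e : s.-tuple {set G}) :
  1 < k -> graph_iso G (cycle_graph (2 * k)) -> edge_enumeration e ->
  [/\ #|G| = 2 * k, bipartite G, has_perfect_matching G &
      exists r : nat, regularity_index (toric_set K e) r /\
                      regularity_index (proj_torus K k) r].
Proof.
move=> k1 [f [[g fK gK] hf]] he.
have k0 : 0 < k := ltnW k1.
have en : ~~ odd (2 * k) by rewrite oddM.
have n2 : 2 < 2 * k by lia.
have cG : #|G| = 2 * k.
  by rewrite (bij_eq_card (Bijective fK gK)) card_ord.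
pose mu b x := g (cycle_partner b (f x)).
have fmu b x : f (mu b x) = cycle_partner b (f x) by rewrite /mu gK.
have muK b : involutive (mu b) by move=> x; rewrite /mu gK cycle_partnerK.
have mu_adj b x : adj x (mu b x) by rewrite -hf fmu /= cycle_partner_rel.
have adj_mu x y : adj x y -> y = mu true x \/ y = mu false x.
  by rewrite -hf => /cycle_relP[] E; [left|right]; rewrite /mu -E.
have bG : bipartite G.
  exists [set x | odd (f x)] => x y /adj_mu xy; rewrite !inE.
  have [b ->] : exists b, y = mu b x by case: xy; [exists true|exists false].
  by rewrite fmu odd_cycle_partner //; case: odd.
have [s1 p1] := involution_matching (muK true) (mu_adj true).
have [s2 p2] := involution_matching (muK false) (mu_adj false).
have mG : has_perfect_matching G by eexists; split; [exact: s1 | exact: p1].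
split=> //; apply: regularity_index_toric_tight => //.
apply: (interpolates_toric_two_matchings k0 cG he p1 p2).
  apply/eqP; rewrite eqEsubset subUset s1 s2 !andbT.
  apply/subsetP => E /edgesP[[x y] /= /adj_mu xy ->]; rewrite inE.
  by case: xy => ->; apply/orP; [left|right]; apply/imsetP; exists x.
(* A common edge would force the two partners of [x] to coincide. *)
rewrite -setI_eq0; apply: contraT => /set0Pn[E /setIP[]].
move=> /imsetP[x _ ->] /imsetP[y _ Exy].
have xy : x \in [set y; mu false y] by rewrite -Exy set21.
have := set22 x (mu true x); rewrite Exy (involution_block (muK false) xy).
case/set2P => [Ex | /(congr1 f)].
  by have := adj_neq (mu_adj true x); rewrite Ex eqxx.
by rewrite !fmu => /eqP; rewrite (negPf (cycle_partner_neq _ n2)).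
Qed.

Lemma complete_bipartite_regularity (m : nat) (G : sgraph) (s : nat)
    (e : s.-tuple {set G}) :
  0 < m -> graph_iso G (complete_bipartite m m) -> edge_enumeration e ->
  [/\ #|G| = 2 * m, bipartite G, has_perfect_matching G &
      exists r : nat, regularity_index (toric_set K e) r /\
                      regularity_index (proj_torus K m) r].
Proof.
move=> m0 [f [[g fK gK] hf]] he.
have cG : #|G| = 2 * m.
  by rewrite (bij_eq_card (Bijective fK gK)) card_sum !card_ord mul2n addnn.
(* Pairs the vertices of equal index on the two sides, giving a perfect matching. *)
pose swap (x : 'I_m + 'I_m) := match x with inl i => inr i | inr i => inl i end.
have [sM pM] : let M := [set [set x; g (swap (f x))] | x : G] in
    M \subset edges G /\ partition M [set: G].
  apply: involution_matching => x; first by rewrite gK; case E: (f x) => /=; rewrite -E fK.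
  by rewrite -hf gK /=; case: (f x).
have mG : has_perfect_matching G by eexists; split; [exact: sM | exact: pM].
pose A := [set x | if f x is inl _ then true else false].
have hA x y : adj x y = ((x \in A) != (y \in A)).
  by rewrite -hf !inE /=; case: (f x); case: (f y).
have hA' (x y : G) : adj x y -> (x \in A) != (y \in A) by rewrite hA.
have bG : bipartite G by exists A.
have cB := card_bipartition hA' mG cG.
have cA : #|A| = m by have := cardsC A; rewrite cB cG; lia.
split=> //; apply: regularity_index_toric_tight => //.
exact: interpolates_toric_complete cA cB hA he.
Qed.

End Families.

Theorem mainTheorem5 (K : finFieldType) (q : nat) (hq : #|K| = q) :
  (forall (k : nat) (G : sgraph) (s : nat) (e : s.-tuple {set G}),
     0 < k -> #|G| = 2 * k -> bipartite G -> has_perfect_matching G ->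
     edge_enumeration e ->
     exists rX rT : nat,
       [/\ regularity_index (toric_set K e) rX,
           regularity_index (proj_torus K k) rT,
           rX >= rT & rT = (q - 2) * (k - 1)]) /\
  (forall (k : nat) (G : sgraph) (s : nat) (e : s.-tuple {set G}),
     1 < k -> graph_iso G (cycle_graph (2 * k)) -> edge_enumeration e ->
     [/\ #|G| = 2 * k, bipartite G, has_perfect_matching G &
         exists r : nat, regularity_index (toric_set K e) r /\
                         regularity_index (proj_torus K k) r]) /\
  (forall (m : nat) (G : sgraph) (s : nat) (e : s.-tuple {set G}),
     0 < m -> graph_iso G (complete_bipartite m m) -> edge_enumeration e ->
     [/\ #|G| = 2 * m, bipartite G, has_perfect_matching G &
         exists r : nat, regularity_index (toric_set K e) r /\
                         regularity_index (proj_torus K m) r]).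
Proof.
subst q; split; [|split].
- move=> k G s e k0 cG bG mG he.
  have s0 : 0 < s by apply: edge_number_gt0 he => //; rewrite cG muln_gt0.
  have [rX hX] : exists r, regularity_index (toric_set K e) r.
    (* The toric set lies in the torus with [s] coordinates; this degree only serves to show that a
       regularity index exists. *)
    apply: (@regularity_index_exists _ _ ((#|K| - 2) * (s - 1))).
    apply: interpolates_torus_points => // P /toric_set_rep[x [t t0 ->] eP].
    by exists (edge_monomials e t) => // i; exact: edge_monomials_neq0.
  exists rX, ((#|K| - 2) * (k - 1)); split=> //; first exact: regularity_index_torus.
  apply: interpolates_toric_lower_bound cG bG mG he _.
  by apply/hilbert_value_card; case: hX.
- exact: even_cycle_regularity.
- exact: complete_bipartite_regularity.
Qed.
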